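(* For $n\ge4$, we have (a) $\displaystyle \widetilde D_n(t)=\sum_{u\in S_n}\phi(u)\,\phi(u^* )\,(4t)^{\mathrm{epk}(u)}(1+t)^{n+1-2\,\mathrm{epk}(u)}$, (b) $\displaystyle D_n(t)=\sum_{u\in S_n}\phi(u^* )\,(4t)^{\mathrm{lpk}(u)}(1+t)^{n-2\,\mathrm{lpk}(u)}$, where $u^*:=u_n\cdots u_2u_1$ is the reversal of $u$ and $$\phi(u):=\begin{cases}1&\text{if }u_{n-2}>u_{n-1}>u_n,\\ 0&\text{if }u_{n-2}>u_n>u_{n-1},\\ 1/2&\text{otherwise.}\end{cases}$$
   Context: $S_n$ is the symmetric group on $\{1,\dots,n\}$, with permutations written $u=u_1\cdots u_n$ and the convention $u_0=u_{n+1}=0$. The number of left peaks of $u$ is $\mathrm{lpk}(u):=|\{i: 1\le i\le n-1,\ u_{i-1}<u_i>u_{i+1}\}|$, and the number of extended peaks is $\mathrm{epk}(u):=|\{i: 1\le i\le n,\ u_{i-1}<u_i>u_{i+1}\}|$. The Weyl group $D_n$ is the group of signed permutations $w$ (permutations of $\{\pm1,\dots,\pm n\}$ with $w(-i)=-w(i)$, written $w=w_1\cdots w_n$ with $w_i=w(i)$) having an even number of negative entries among $w_1,\dots,w_n$. The descent set $\mathrm{Des}(w)$ of $w\in D_n$ consists of all $i\in\{2,\dots,n\}$ with $w_{i-1}>w_i$, together with $1$ if $w_1+w_2<0$. The affine descent set $\widetilde{\mathrm{Des}}(w)\subseteq\{0,1,\dots,n\}$ is $\mathrm{Des}(w)$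 together with $0$ if $w_{n-1}+w_n>0$. The Eulerian and affine Eulerian polynomials of type $D$ are $D_n(t)=\sum_{w\in D_n}t^{|\mathrm{Des}(w)|}$ and $\widetilde D_n(t)=\sum_{w\in D_n}t^{|\widetilde{\mathrm{Des}}(w)|}$. *)

(* Defs.v *)
From mathcomp Require Import all_boot all_order all_fingroup all_algebra.

Set Implicit Arguments.
Unset Strict Implicit.
Unset Printing Implicit Defensive.

Import Order.TTheory GRing.Theory Num.Theory.
Local Open Scope ring_scope.

(* {1, ..., n} is encoded as 'I_n, with i : 'I_n standing for i + 1; [letter]
   restores the 1-based convention, and u_0 = u_(n+1) = 0. *)
Definition letter (n : nat) (u : 'S_n) (k : nat) : nat :=
  if k is i.+1 then oapp (fun j : 'I_n => (u j).+1) 0%N (insub i) else 0%N.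

Definition is_peak (n : nat) (u : 'S_n) (i : nat) : bool :=
  (letter u i.-1 < letter u i)%N && (letter u i.+1 < letter u i)%N.

Definition lpk (n : nat) (u : 'S_n) : nat :=
  #|[set i : 'I_n.+1 | (1 <= i <= n.-1)%N && is_peak u i]|.

Definition epk (n : nat) (u : 'S_n) : nat :=
  #|[set i : 'I_n.+1 | (1 <= i <= n)%N && is_peak u i]|.

(* Products of permutations compose left to right:
   (reversal u) i = u (rev_ord i). *)
Definition reversal (n : nat) (u : 'S_n) : 'S_n :=
  (perm (@rev_ord_inj n) * u)%g.

Definition phi (n : nat) (u : 'S_n) : rat :=
  let a := letter u (n - 2) in
  let b := letter u (n - 1) in
  let c := letter u n in
  if (a > b)%N && (b > c)%N then 1
  else if (a > c)%N && (c > b)%N then 0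
  else 1 / 2%:R.

(* {+1, -1, ..., +n, -n}: the pair (b, i) stands for i + 1 if b = false and for
   -(i + 1) if b = true. *)
Notation signed n := (bool * 'I_n)%type.

Definition sopp (n : nat) (x : signed n) : signed n := (~~ x.1, x.2).

Definition sval_int (n : nat) (x : signed n) : int :=
  if x.1 then - (x.2.+1)%:Z else (x.2.+1)%:Z.

(* w_k = w(k) for 1 <= k <= n; the value 0 outside this range is junk. *)
Definition sletter (n : nat) (w : {perm signed n}) (k : nat) : int :=
  if k is i.+1 then
    oapp (fun j : 'I_n => sval_int (w (false, j))) 0 (insub i)
  else 0.

Definition weylD (n : nat) : {set {perm signed n}} :=
  [set w : {perm signed n} | [forall x, w (sopp x) == sopp (w x)] &&
           ~~ odd #|[set k : 'I_n | sletter w k.+1 < 0]|].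

Definition Des (n : nat) (w : {perm signed n}) : {set 'I_n.+1} :=
  [set i : 'I_n.+1 |
     (2 <= i <= n)%N && (sletter w i.-1 > sletter w i)
     || (i == 1%N :> nat) && (sletter w 1 + sletter w 2 < 0)].

Definition affDes (n : nat) (w : {perm signed n}) : {set 'I_n.+1} :=
  Des w :|:
  [set i : 'I_n.+1 |
     (i == 0%N :> nat) && (sletter w (n - 1) + sletter w n > 0)].

Definition eulerianD (n : nat) : {poly rat} :=
  \sum_(w in weylD n) 'X^#|Des w|.

Definition aff_eulerianD (n : nat) : {poly rat} :=
  \sum_(w in weylD n) 'X^#|affDes w|.

(* Main.v *)
(* Fix |w| = u and let the signs vary.  Each descent condition between two
   adjacent letters depends only on the sign of the letter of larger absolute
   value, so the sum of t^des over all signs is a product of factors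
   t^a + t^b, one per letter.  All the statistics are unchanged by flipping the
   sign of w_1, so summing over all signs gives twice the sum over D_n.
   In a product of the shape occurring for types B and C, a peak contributes 2t,
   a valley 2 and any other letter 1 + t.  The type D factors of the first two
   letters differ from the type B ones, weighted by 2 phi(u^* ), only when
   u_1, u_2 < u_3; the difference then changes sign under exchanging u_1 and
   u_2, while the remaining factors do not change.  Hence the two weights have
   equal sums over S_n, and likewise at the other end in the affine case. *)
Require Import Defs.
From mathcomp Require Import all_boot all_order all_fingroup all_algebra.
From mathcomp Require Import zify ring.

Set Implicit Arguments.
Unset Strict Implicit.
Unset Printing Implicit Defensive.

Import Order.TTheory GRing.Theory Num.Theory.
Local Open Scope ring_scope.

Local Arguments letter : simpl never.
Local Arguments sletter : simpl never.

(** * Signed permutations as pairs of a permutation and a sign vector *)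

Definition sign_act n (u : 'S_n) (e : {ffun 'I_n -> bool}) (x : signed n) :
    signed n :=
  (x.1 (+) e x.2, u x.2).

Lemma sign_act_inj n (u : 'S_n) (e : {ffun 'I_n -> bool}) :
  injective (sign_act u e).
Proof.
move=> [b i] [c j] [/= hb /perm_inj hij]; move: hb; rewrite hij.
by move=> /addIb ->.
Qed.

(* The pair (u, e) encodes the signed permutation w with |w_k| = u_k and w_k < 0
   exactly when e holds at k. *)
Definition signed_perm n (p : 'S_n * {ffun 'I_n -> bool}) : {perm signed n} :=
  perm (@sign_act_inj n p.1 p.2).

Lemma signed_perm_inj n : injective (@signed_perm n).
Proof.
move=> [u e] [u' e'] /permP h; congr pair.
  by apply/permP => i; have := h (false, i); rewrite !permE => -[].
by apply/ffunP => i; have := h (false, i); rewrite !permE => -[].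
Qed.

Lemma sletter_signed_perm n (u : 'S_n) (e : {ffun 'I_n -> bool}) (j : 'I_n) :
  sletter (signed_perm (u, e)) j.+1 = sval_int (e j, u j).
Proof. by rewrite /sletter valK /= permE. Qed.

Lemma weylD_signed_perm n :
  weylD n =
    @signed_perm n @: [set p : _ * {ffun _} | ~~ odd #|[set k | p.2 k]|].
Proof.
have sgn (u : 'S_n) e : [set k : 'I_n | sletter (signed_perm (u, e)) k.+1 < 0]
    = [set k | e k].
  by apply/setP=> k; rewrite !inE sletter_signed_perm /sval_int /=; case: (e k).
apply/setP => w; rewrite inE; apply/andP/imsetP => [[/forallP wN ev]|].
  have wE x : w (sopp x) = sopp (w x) by apply/eqP.
  (* If two positive arguments have images of equal absolute value, equal signs contradict
     injectivity of [w] unless [i = j], and opposite signs would give [w(i) = w(-j)]. *)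
  have uI : injective (fun i => (w (false, i)).2).
    move=> i j hij; have [|/eqP ne] := (w (false, i)).1 =P (w (false, j)).1.
      move=> h; have /perm_inj[] // : w (false, i) = w (false, j).
      by move: hij h; case: (w _) (w _) => [? ?] [? ?] /= -> ->.
    have /perm_inj[] // : w (false, i) = w (sopp (false, j)).
    rewrite wE; move: hij ne.
    by case: (w _) (w _) => [[] ?] [[] ?] //= ->.
  have wP : w = signed_perm (perm uI, [ffun i => (w (false, i)).1]).
    apply/permP => -[b i]; rewrite !permE /sign_act /= permE ffunE.
    case: b => /=; last by case: (w _).
    by rewrite -[(true, i)]/(sopp (false, i)) wE; case: (w _).
  exists (perm uI, [ffun i => (w (false, i)).1]) => //.
  by rewrite inE -(sgn (perm uI)) -wP.
case=> -[u e]; rewrite inE /= => ev ->; rewrite sgn; split=> //.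
apply/forallP=> -[b i]; rewrite !permE /sign_act /sopp /=.
by rewrite addNb.
Qed.

Lemma sum_weylD n (V : nmodType) (F : {perm signed n} -> V) :
  \sum_(w in weylD n) F w =
    \sum_u \sum_(e : {ffun 'I_n -> bool} | ~~ odd #|[set k | e k]|)
      F (signed_perm (u, e)).
Proof.
rewrite weylD_signed_perm big_imset /=; last by move=> ? ? _ _ /signed_perm_inj.
rewrite pair_big_dep /=.
by apply: eq_big => [[u e]|[u e] _] //; rewrite inE.
Qed.

(** * Summation over the signs *)

(** Flipping the sign at [ord0] is an involution that changes the parity and, since [A] and [B]
    agree there, preserves the product. So the even and the odd halves have equal sums, and together
    they expand the right-hand side. *)
Lemma sum_even_signs (R : comPzRingType) n (A B : 'I_n.+1 -> R) :
    A ord0 = B ord0 ->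
  (\sum_(e : {ffun 'I_n.+1 -> bool} | ~~ odd #|[set k | e k]|)
      \prod_j (if e j then A j else B j)) *+ 2 = \prod_j (A j + B j).
Proof.
move=> AB0; pose flip (e : {ffun 'I_n.+1 -> bool}) :=
  [ffun j => (j == ord0) (+) e j].
have flipK : involutive flip.
  by move=> e; apply/ffunP=> j; rewrite !ffunE addbA addbb.
have odd_flip e : odd #|[set k | flip e k]| = ~~ odd #|[set k | e k]|.
  rewrite (cardsD1 ord0) [in RHS](cardsD1 ord0) !inE ffunE eqxx /=.
  rewrite !oddD; set a := odd #|_|; set b := odd #|_|.
  have -> : a = b.
    rewrite /a /b; congr (odd #|pred_of_set _|); apply/setP=> k.
    by rewrite !inE ffunE; case: (k == _).
  by case: (e _) b => [] [].
transitivity (\sum_(e : {ffun 'I_n.+1 -> bool})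
                 \prod_j (if e j then A j else B j)); last first.
  transitivity (\prod_j \sum_(b : bool) (if b then A j else B j)).
    by rewrite bigA_distr_bigA.
  by apply: eq_bigr => j _; rewrite big_bool.
rewrite mulr2n [RHS](bigID (fun e : {ffun _} => ~~ odd #|[set k | e k]|)) /=.
congr (_ + _); rewrite (reindex_inj (inv_inj flipK)) /=.
apply: eq_big => [e|e _]; first by rewrite odd_flip.
apply: eq_bigr => j _; rewrite ffunE.
by have [->|//] := eqVneq j ord0; case: (e _).
Qed.

(** A factor is [2x] at a peak (bits 1, 0), [2] at a valley (bits 0, 1) and [1 + x] otherwise. Peaks
    and valleys alternate, starting with a peak because of [s 0]. They are equally many if [s n]
    holds; otherwise there is one more peak, and doubling [P] supplies the missing [2]. *)
Lemma prod_bits (R : comNzRingType) (x : R) (s : nat -> bool) n : s 0%N ->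
  let p := (\sum_(0 <= j < n) (s j && ~~ s j.+1))%N in
  let P := \prod_(0 <= j < n) (x ^+ s j + x ^+ ~~ s j.+1) in
  if s n then ((2 * p <= n)%N /\ P = (4%:R * x) ^+ p * (1 + x) ^+ (n - 2 * p))
  else (2 * p <= n + 1)%N /\
       P *+ 2 = (4%:R * x) ^+ p * (1 + x) ^+ (n + 1 - 2 * p).
Proof.
move=> s0; elim: n => [|n IH] /=; first by rewrite s0 !big_geq // !expr0 mulr1.
rewrite !big_nat_recr //=; move: IH => /=.
set p := (\sum_(0 <= j < n) _)%N; set P := \prod_(0 <= j < n) _.
case: (s n) => -[le_p E]; case: (s n.+1) => /=; rewrite ?addn0 ?expr0 ?expr1.
- split; first lia.
  by rewrite E -mulrA [x + 1]addrC -exprSr; congr (_ * _ ^+ _); lia.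
- split; first lia.
  rewrite E addn1 [in RHS]exprS.
  have -> : (n.+1 + 1 - 2 * p.+1 = n - 2 * p)%N by lia.
  ring.
- split; first lia.
  have -> : (n.+1 - 2 * p = n + 1 - 2 * p)%N by lia.
  by rewrite -E; ring.
- split; first lia.
  rewrite -mulrnAl E -mulrA -exprSr.
  by congr (_ * _ ^+ _); lia.
Qed.

(** * Letters and ascents *)

Lemma letter_ord n (u : 'S_n) (i : 'I_n) : letter u i.+1 = (u i).+1.
Proof. by rewrite /letter valK. Qed.

Lemma letter_eq n (u : 'S_n) i j : (i < n)%N -> (j < n)%N ->
  (letter u i.+1 == letter u j.+1) = (i == j).
Proof.
move=> lt_i lt_j; rewrite (letter_ord u (Ordinal lt_i)).
rewrite (letter_ord u (Ordinal lt_j)) eqSS.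
by rewrite (inj_eq val_inj) (inj_eq perm_inj).
Qed.

Lemma letter_gt0 n (u : 'S_n) i : (i < n)%N -> (0 < letter u i.+1)%N.
Proof. by move=> lt_i; rewrite (letter_ord u (Ordinal lt_i)). Qed.

Lemma letter_out n (u : 'S_n) : letter u n.+1 = 0%N.
Proof. by rewrite /letter insubF // ltnn. Qed.

Definition ascent n (u : 'S_n) (j : nat) : bool :=
  (letter u j < letter u j.+1)%N.

Lemma descentE n (u : 'S_n) i : (i.+1 < n)%N ->
  (letter u i.+2 < letter u i.+1)%N = ~~ ascent u i.+1.
Proof.
rewrite /ascent => lt_i; have := letter_eq u (ltnW lt_i) lt_i.
by rewrite [X in _ = X]ltn_eqF //; lia.
Qed.

(** * Descent numbers as sums with one term per letter *)

Definition is_neg n (e : {ffun 'I_n -> bool}) (j : nat) : bool :=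
  oapp e false (insub j).

Lemma sletterE n (u : 'S_n) (e : {ffun 'I_n -> bool}) i : (i < n)%N ->
  sletter (signed_perm (u, e)) i.+1 =
    if is_neg e i then - (letter u i.+1)%:Z else (letter u i.+1)%:Z.
Proof.
move=> lt_i; rewrite (sletter_signed_perm u e (Ordinal lt_i)).
by rewrite (letter_ord u (Ordinal lt_i)) /is_neg insubT.
Qed.

(** The letter of larger absolute value decides: a larger second letter makes a descent when
    negative, a larger first one when positive. *)
Lemma descent_split (a b : nat) (e f : bool) :
  (0 < a)%N -> (0 < b)%N -> a != b ->
  ((if f then - b%:Z else b%:Z) < (if e then - a%:Z else a%:Z)) =
    ((a < b) && f + (b < a) && ~~ e)%N :> nat.
Proof. by case: e f => [] []; lia. Qed.

(* Index j stands for the letter in position j + 1: a negative sign there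
   contributes neg_wt u j descents, a positive one pos_wt u j. *)
Definition neg_wt n (u : 'S_n) (j : nat) : nat :=
  (((0 < j) && (letter u j < letter u j.+1))
  + ((j == 0) && (letter u 2 < letter u 1))
  + ((j == 1) && (letter u 1 < letter u 2)))%N.

Definition pos_wt n (u : 'S_n) (j : nat) : nat :=
  (j.+1 < n)%N && (letter u j.+2 < letter u j.+1)%N.

Definition aff_pos_wt n (u : 'S_n) (j : nat) : nat :=
  (pos_wt u j
  + ((j.+1 == n) && (letter u n.-1 < letter u n))
  + ((j.+2 == n) && (letter u n < letter u n.-1)))%N.

Lemma card_set_ord n (P : nat -> bool) :
  #|[set i : 'I_n | P i]| = (\sum_(0 <= i < n) P i)%N.
Proof.
rewrite big_mkord -sum1_card big_mkcond /=; apply: eq_bigr => i _.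
by rewrite inE; case: (P i).
Qed.

Lemma card_Des m (u : 'S_m.+2) (e : {ffun 'I_m.+2 -> bool}) :
  #|Des (signed_perm (u, e))| =
    (\sum_(0 <= j < m.+2) if is_neg e j then neg_wt u j else pos_wt u j)%N.
Proof.
set w := signed_perm _.
rewrite /Des (card_set_ord _ (fun i =>
  (2 <= i <= m.+2)%N && (sletter w i.-1 > sletter w i)
  || (i == 1%N :> nat) && (sletter w 1 + sletter w 2 < 0))).
rewrite big_nat_recl // big_nat_recl //= add0n.
have -> : (sletter w 1 + sletter w 2 < 0) =
  ((is_neg e 0 && (letter u 2 < letter u 1)) +
   (is_neg e 1 && (letter u 1 < letter u 2)))%N :> nat.
  have := letter_eq u (isT : 0 < m.+2)%N (isT : 1 < m.+2)%N.
  have := letter_gt0 u (isT : 0 < m.+2)%N.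
  have := letter_gt0 u (isT : 1 < m.+2)%N.
  by rewrite /w !sletterE //; case: is_neg; case: is_neg; lia.
rewrite (eq_big_nat _ _ (F2 := fun j =>
   ((is_neg e j.+1 && (letter u j.+1 < letter u j.+2))
     + (~~ is_neg e j && (letter u j.+2 < letter u j.+1)))%N)); last first.
  move=> j /andP[_ lt_j]; have lt_j1 : (j.+1 < m.+2)%N by [].
  have lt_j0 := ltnW lt_j1; rewrite orbF lt_j1 /= /w !sletterE //.
  rewrite descent_split ?letter_gt0 ?letter_eq // ?(ltn_eqF (ltnSn j)) //.
  by rewrite andbC [in X in (_ + X)%N]andbC.
(* The terms by letter are split by origin. Those of the negative letters shift by one index to
   match the positions; the boundary terms at [j = 0] and [j = m.+1] vanish. *)
rewrite big_split /= [RHS](eq_big_nat _ _ (F2 := fun j =>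
  ((is_neg e j && ((0 < j) && (letter u j < letter u j.+1)))
   + (~~ is_neg e j && ((j.+1 < m.+2) && (letter u j.+2 < letter u j.+1)))
   + ((j == 0) && is_neg e 0 && (letter u 2 < letter u 1))
   + ((j == 1) && is_neg e 1 && (letter u 1 < letter u 2)))%N)); last first.
  move=> j _; rewrite /neg_wt /pos_wt; case: eqP => [->|_].
    by case: (is_neg e 0); rewrite /= ?addn0.
  by case: eqP => [->|_]; case: (is_neg e _); rewrite /= ?addn0 ?andbT.
rewrite !big_split /= [in RHS]big_nat_recl // andbF add0n.
rewrite [X in _ = (_ + X + _ + _)%N]big_nat_recr //= ltnn !andbF addn0.
rewrite [X in _ = (_ + X + _)%N]big_nat_recl //= big1_eq addn0.
rewrite [X in _ = (_ + X)%N]big_nat_recl //=.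
rewrite [X in _ = (_ + (_ + X))%N]big_nat_recl //=.
rewrite big1_eq addn0 add0n addnC addnA; congr (_ + _ + _ + _)%N.
by apply: eq_big_nat => j /andP[_ lt_j]; rewrite ltnS lt_j.
Qed.

Lemma card_affDes m (u : 'S_m.+2) (e : {ffun 'I_m.+2 -> bool}) :
  #|affDes (signed_perm (u, e))| =
    (\sum_(0 <= j < m.+2) if is_neg e j then neg_wt u j else aff_pos_wt u j)%N.
Proof.
rewrite /affDes cardsU card_Des; set w := signed_perm _.
(* [Des w] never contains 0, so the union is disjoint. *)
have -> : Des w :&: [set i : 'I_m.+3 | (i == 0%N :> nat) &&
    (0 < sletter w m.+1 + sletter w m.+2)] = set0.
  by apply/setP=> i; rewrite !inE; case: i => -[|i] //=; rewrite andbF.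
rewrite cards0 subn0.
rewrite (card_set_ord _ (fun i =>
  (i == 0%N) && (0 < sletter w m.+1 + sletter w m.+2))).
rewrite [X in (_ + X)%N = _]big_nat_recl //= big1_eq addn0.
have -> : (0 < sletter w m.+1 + sletter w m.+2) =
  ((~~ is_neg e m && (letter u m.+2 < letter u m.+1)) +
   (~~ is_neg e m.+1 && (letter u m.+1 < letter u m.+2)))%N :> nat.
  have := letter_eq u (ltnW (ltnSn m.+1)) (ltnSn m.+1).
  have := letter_gt0 u (ltnW (ltnSn m.+1)); have := letter_gt0 u (ltnSn m.+1).
  by rewrite /w !sletterE //; case: (is_neg e _); case: (is_neg e _); lia.
rewrite !big_nat_recr //= /aff_pos_wt /= !eqxx !eqSS ltn_eqF // gtn_eqF //=.
have -> : (\sum_(0 <= i < m) (if is_neg e i then neg_wt u i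
     else pos_wt u i + ((i.+1 == m.+2) && (letter u m.+1 < letter u m.+2)) +
       ((i.+2 == m.+2) && (letter u m.+2 < letter u m.+1)))
   = \sum_(0 <= i < m) if is_neg e i then neg_wt u i else pos_wt u i)%N.
  apply: eq_big_nat => i /andP[_ lt_i].
  by rewrite !eqSS !ltn_eqF ?addn0 // ltnW.
by case: (is_neg e _); case: (is_neg e _); rewrite /= ?addn0; lia.
Qed.

(** * Products over letters, and the exchange of D-type for B-type ends *)

Definition factor (a b : nat) : {poly rat} := 'X^a + 'X^b.

(* The factors of the two letters a, b at a D-type end of the word, c being the
   next letter; factorB replaces the end by a B-type one and inserts the weight
   2 phi. *)
Definition factorD (a b c : nat) : {poly rat} :=
  factor (b < a)%N (b < a)%N * factor ((a < b) + (a < b))%N (c < b)%N.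

(** [phi] as a function of the three letters it reads, so that it serves both ends of the word.
    [factorB] calls it with the boundary letter last. *)
Definition phi3 (a b c : nat) : rat :=
  if (a > b)%N && (b > c)%N then 1
  else if (a > c)%N && (c > b)%N then 0
  else 1 / 2%:R.

Definition factorB (a b c : nat) : {poly rat} :=
  (phi3 c b a *: (factor 1 (b < a)%N * factor (a < b)%N (c < b)%N)) *+ 2.

Lemma sum_weylD_signs m (f : {perm signed m.+1} -> nat)
    (l r : 'S_m.+1 -> nat -> nat) :
    (forall u, l u 0%N = r u 0%N) ->
    (forall u e, f (signed_perm (u, e)) =
       \sum_(0 <= j < m.+1) if is_neg e j then l u j else r u j)%N ->
  (\sum_(w in weylD m.+1) 'X^(f w)) *+ 2 =
    \sum_u \prod_(0 <= j < m.+1) factor (l u j) (r u j).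
Proof.
move=> lr0 fE; rewrite sum_weylD -sumrMnl; apply: eq_bigr => u _.
rewrite big_mkord -sum_even_signs ?lr0 //; congr (_ *+ 2).
apply: eq_bigr => e _; rewrite fE expr_sum big_mkord; apply: eq_bigr => j _.
by rewrite /is_neg valK /=; case: (e j).
Qed.

Lemma eulerianD_sum m :
  eulerianD m.+2 *+ 2 =
    \sum_(u : 'S_m.+2) \prod_(0 <= j < m.+2) factor (neg_wt u j) (pos_wt u j).
Proof.
apply: sum_weylD_signs => [u|]; last exact: card_Des.
by rewrite /neg_wt /= addn0.
Qed.

(** With length at least 3 the affine terms, which sit at the last two letters, miss index 0, where
    both signs must have equal weight. *)
Lemma aff_eulerianD_sum m :
  aff_eulerianD m.+3 *+ 2 =
    \sum_(u : 'S_m.+3)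
      \prod_(0 <= j < m.+3) factor (neg_wt u j) (aff_pos_wt u j).
Proof.
apply: sum_weylD_signs => [u|]; last exact: card_affDes.
by rewrite /neg_wt /aff_pos_wt /= !addn0.
Qed.

(** Inspection of the six orders. If [c] is not the largest, the weight [2 phi] is 1 and the two
    products agree. For [a < b < c] the weight is 2 and the difference is [-4t]; for [b < a < c] the
    weight is 0 and the difference is [4t]. *)
Lemma factorD_sub a b c : a != b -> a != c -> b != c ->
  factorD a b c - factorB a b c =
    if (a < c)%N && (b < c)%N then - (factorD b a c - factorB b a c) else 0.
Proof.
rewrite /factorD /factorB /phi3 /factor => ab ac bc.
have half2 (p : {poly rat}) : ((1 / 2%:R) *: p) *+ 2 = p.
  by rewrite -scaler_nat scalerA mulrC divfK // scale1r.
case: (ltngtP a b) ab => // lab _; case: (ltngtP a c) ac => // lac _;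
  case: (ltngtP b c) bc => // lbc _ /=; try (exfalso; lia);
  rewrite ?half2 ?scale1r ?scale0r ?expr0 ?expr1 /=; ring.
Qed.

(** Exchanging the letters at indices [i] and [j] negates each term of the difference, so the total
    difference is its own negative. Invariance of [H] matters only where that difference can be
    nonzero. *)
Lemma sum_factorD_factorB n (i j k : nat) (H : 'S_n -> {poly rat}) :
    (i < n)%N -> (j < n)%N -> (k < n)%N -> i != j -> i != k -> j != k ->
    (forall u v : 'S_n,
       letter v i.+1 = letter u j.+1 -> letter v j.+1 = letter u i.+1 ->
       (forall l, l != i -> l != j -> letter v l.+1 = letter u l.+1) ->
       (letter u i.+1 < letter u k.+1)%N -> (letter u j.+1 < letter u k.+1)%N ->
     H v = H u) ->
  \sum_u factorD (letter u i.+1) (letter u j.+1) (letter u k.+1) * H u =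
  \sum_u factorB (letter u i.+1) (letter u j.+1) (letter u k.+1) * H u.
Proof.
move=> lti ltj ltk ij ik jk HE; apply/eqP; rewrite -subr_eq0 -sumrB.
under eq_bigr do rewrite -mulrBl.
pose D (u : 'S_n) := factorD (letter u i.+1) (letter u j.+1) (letter u k.+1)
   - factorB (letter u i.+1) (letter u j.+1) (letter u k.+1).
pose t := tperm (Ordinal lti) (Ordinal ltj).
have [ti tj] : (forall u, letter (t * u)%g i.+1 = letter u j.+1) /\
               (forall u, letter (t * u)%g j.+1 = letter u i.+1).
  by split=> u; rewrite (letter_ord _ (Ordinal lti))
    (letter_ord _ (Ordinal ltj)) permM ?tpermL ?tpermR.
have tl u l : l != i -> l != j -> letter (t * u)%g l.+1 = letter u l.+1.
  move=> li lj; have [ltl|gel] := ltnP l n; last first.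
    by rewrite /letter insubF // ltnNge gel.
  by rewrite !(letter_ord _ (Ordinal ltl)) permM tpermD // -val_eqE /= eq_sym.
have anti u : D (t * u)%g * H (t * u)%g = - (D u * H u).
  rewrite -mulNr /D ti tj tl 1?eq_sym //.
  rewrite [X in _ = - X * _]factorD_sub ?letter_eq //.
  case: ifP => [/andP[lt1 lt2]|geq].
    by rewrite opprK (HE u) // => l; apply: tl.
  rewrite factorD_sub ?letter_eq //; last by rewrite eq_sym.
  by rewrite andbC geq oppr0 !mul0r.
have E : \sum_u D u * H u = - \sum_u D u * H u.
  rewrite -sumrN [LHS](reindex_inj (mulgI t)) /=.
  by apply: eq_bigr => u _; rewrite anti.
by move/eqP: E; rewrite -addr_eq0 -mulr2n -scaler_nat scaler_eq0 pnatr_eq0.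
Qed.

(** * Splitting of the products into two ends and a middle *)

Lemma factorC a b : factor a b = factor b a.
Proof. by rewrite /factor addrC. Qed.

Definition middle m (u : 'S_m.+4) : {poly rat} :=
  \prod_(2 <= j < m.+2)
    factor (letter u j < letter u j.+1)%N (letter u j.+2 < letter u j.+1)%N.

(** The exponent 0 arises because a positive last letter makes no descent in the finite case. *)
Definition last_fin m (u : 'S_m.+4) : {poly rat} :=
  factor (letter u m.+2 < letter u m.+3)%N (letter u m.+4 < letter u m.+3)%N *
  factor (letter u m.+3 < letter u m.+4)%N 0.

Lemma prod_split4 m (f : nat -> {poly rat}) :
  \prod_(0 <= j < m.+4) f j =
    f 0%N * f 1%N * (\prod_(2 <= j < m.+2) f j) * (f m.+2 * f m.+3).
Proof. by rewrite 2?big_nat_recr //= big_ltn // big_ltn // !mulrA. Qed.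

Lemma prod_D_fin m (u : 'S_m.+4) :
  \prod_(0 <= j < m.+4) factor (neg_wt u j) (pos_wt u j) =
  factorD (letter u 1) (letter u 2) (letter u 3) * (middle u * last_fin u).
Proof.
rewrite prod_split4 -mulrA; congr (_ * (_ * _)).
- by rewrite /neg_wt /pos_wt /= !addn0 add0n.
- apply: eq_big_nat => -[|[|j]] // lt_j.
  by rewrite /neg_wt /pos_wt /= !addn0 (_ : j.+3 < m.+4)%N //; lia.
- by rewrite /neg_wt /pos_wt /= !addn0 !ltnS !leqnn ltnn.
Qed.

(** The right end is a D-type end read backwards, with the roles of the two signs exchanged. *)
Lemma prod_D_aff m (u : 'S_m.+4) :
  \prod_(0 <= j < m.+4) factor (neg_wt u j) (aff_pos_wt u j) =
  factorD (letter u 1) (letter u 2) (letter u 3) * (middle u *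
    factorD (letter u m.+4) (letter u m.+3) (letter u m.+2)).
Proof.
rewrite prod_split4 -mulrA; congr (_ * (_ * _)).
- by rewrite /neg_wt /aff_pos_wt /pos_wt /= !addn0 add0n.
- apply: eq_big_nat => -[|[|j]] // lt_j.
  rewrite /neg_wt /aff_pos_wt /pos_wt /= !addn0 !eqSS !ltn_eqF ?addn0; try lia.
  by rewrite (_ : j.+3 < m.+4)%N //; lia.
- rewrite /neg_wt /aff_pos_wt /pos_wt /= !addn0 !eqSS eqxx.
  rewrite (gtn_eqF (ltnSn m)) (ltn_eqF (ltnSn m)).
  rewrite ltnn !ltnS leqnn /= addn0 add0n /factorD mulrC; congr (_ * _).
  by rewrite addn0.
by rewrite factorC.
Qed.

(** The exchanged letters can enter only through the comparison of positions 2 and 3, which is an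
    ascent before and after. *)
Lemma middle_swap_first m (u v : 'S_m.+4) :
    letter v 2 = letter u 1 ->
    (forall l, (1 < l)%N -> letter v l.+1 = letter u l.+1) ->
    (letter u 1 < letter u 3)%N -> (letter u 2 < letter u 3)%N ->
  middle v = middle u.
Proof.
move=> v2 vl lt13 lt23; apply: eq_big_nat => -[|[|[|j]]] // _.
  by rewrite v2 !vl // lt13 lt23.
by rewrite !vl.
Qed.

Lemma middle_swap_last m (u v : 'S_m.+4) :
    letter v m.+3 = letter u m.+4 ->
    (forall l, (l < m.+2)%N -> letter v l.+1 = letter u l.+1) ->
    (letter u m.+4 < letter u m.+2)%N -> (letter u m.+3 < letter u m.+2)%N ->
  middle v = middle u.
Proof.
move=> vm vl lt42 lt32; apply: eq_big_nat => -[|j] // /andP[_ lt_j].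
rewrite !(vl j) ?(vl j.+1) //; last lia.
have [->|ne] := eqVneq j m; first by rewrite vm lt42 lt32.
by rewrite vl //; lia.
Qed.

Lemma letter_reversal n (u : 'S_n) i j : (i + j).+1 = n ->
  letter (reversal u) i.+1 = letter u j.+1.
Proof.
move=> ijn; have lti : (i < n)%N by lia.
have ltj : (j < n)%N by lia.
rewrite (letter_ord _ (Ordinal lti)) (letter_ord _ (Ordinal ltj)) permM permE.
by congr (val (u _)).+1; apply: val_inj => /=; lia.
Qed.

Lemma phiE m (u : 'S_m.+4) :
  phi u = phi3 (letter u m.+2) (letter u m.+3) (letter u m.+4).
Proof. by rewrite /phi !subSS !subn0. Qed.

Lemma phi_reversalE m (u : 'S_m.+4) :
  phi (reversal u) = phi3 (letter u 3) (letter u 2) (letter u 1).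
Proof.
by rewrite phiE (@letter_reversal _ _ m.+1 2) 1?(@letter_reversal _ _ m.+2 1)
  1?(@letter_reversal _ _ m.+3 0) //; lia.
Qed.

Lemma sum_D_fin m :
  \sum_(u : 'S_m.+4)
    factorD (letter u 1) (letter u 2) (letter u 3) * (middle u * last_fin u) =
  \sum_(u : 'S_m.+4)
    factorB (letter u 1) (letter u 2) (letter u 3) * (middle u * last_fin u).
Proof.
apply: (@sum_factorD_factorB _ 0 1 2) => // u v v1 v2 vl lt13 lt23.
have vl' l : (1 < l)%N -> letter v l.+1 = letter u l.+1.
  by case: l => [|[|l]] // _; apply: vl.
rewrite (middle_swap_first v2 vl') // /last_fin; congr (_ * (_ * _));
  last by rewrite !vl'.
(* For [n = 4] the second letter also enters [last_fin], but only by being smaller than the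
   third. *)
by case: m => [|m] in u v v1 v2 vl lt13 lt23 vl' *;
  rewrite ?v2 !vl' ?lt13 ?lt23.
Qed.

Lemma sum_D_aff m :
  \sum_(u : 'S_m.+4) factorD (letter u 1) (letter u 2) (letter u 3) *
    (middle u * factorD (letter u m.+4) (letter u m.+3) (letter u m.+2)) =
  \sum_(u : 'S_m.+4) factorB (letter u 1) (letter u 2) (letter u 3) *
    (middle u * factorB (letter u m.+4) (letter u m.+3) (letter u m.+2)).
Proof.
(* The ends are replaced one at a time, the other end being part of [H]. *)
transitivity (\sum_(u : 'S_m.+4)
    factorB (letter u 1) (letter u 2) (letter u 3) *
    (middle u * factorD (letter u m.+4) (letter u m.+3) (letter u m.+2))).
  apply: (@sum_factorD_factorB _ 0 1 2) => // u v v1 v2 vl lt13 lt23.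
  have vl' l : (1 < l)%N -> letter v l.+1 = letter u l.+1.
    by case: l => [|[|l]] // _; apply: vl.
  rewrite (middle_swap_first v2 vl') //; congr (_ * _).
  case: m => [|m] in u v v1 v2 vl lt13 lt23 vl' *; last by rewrite !vl'.
  by rewrite /factorD v2 !vl' // lt13 lt23.
under eq_bigr do rewrite mulrA mulrC; under [RHS]eq_bigr do rewrite mulrA mulrC.
apply: (@sum_factorD_factorB _ m.+3 m.+2 m.+1) => //; try lia.
move=> u v vn vm vl lt42 lt32.
have vl' l : (l < m.+2)%N -> letter v l.+1 = letter u l.+1.
  by move=> ltl; apply: vl; lia.
rewrite (middle_swap_last vm vl') //; congr (_ * _).
rewrite !(vl' 0%N, vl' 1%N) //.
(* For [n = 4] the third letter of the left [factorB] is an exchanged one. It stays below the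
   second, which forces [phi3] to be 1/2 on both sides. *)
case: m => [|m] in u v vn vm vl lt42 lt32 vl' *; last by rewrite vl'.
rewrite /factorB /phi3 vm lt42 lt32 (leq_gtF (ltnW lt42)) (leq_gtF (ltnW lt32)).
rewrite [X in if X then 0 else _](_ : _ = false); last lia.
by rewrite [in RHS](_ : (letter u 1 < letter u 3) && _ = false)%N; last lia.
Qed.

(** * Peaks as bit patterns, and evaluation of the B-type products *)

Lemma epk_ascent n (u : 'S_n) :
  epk u = (\sum_(0 <= j < n) (ascent u j && ~~ ascent u j.+1))%N.
Proof.
rewrite /epk (card_set_ord _ (fun i => (1 <= i <= n)%N && is_peak u i)).
rewrite big_nat_recl //= add0n; apply: eq_big_nat => j /andP[_ lt_j].
rewrite lt_j /is_peak /ascent /=.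
have [lt|ge] := ltnP j.+1 n; first by rewrite descentE.
have -> : j.+1 = n by lia.
by case: n u ge lt_j => // k u ge lt_j; rewrite letter_out letter_gt0.
Qed.

(** Setting the bit at [n] to true suppresses a peak at [n], the one position where [lpk] and [epk]
    differ. It also selects the undoubled case of [prod_bits]. *)
Lemma lpk_ascent n (u : 'S_n) (s := fun j => ascent u j || (j == n)) :
  lpk u = (\sum_(0 <= j < n) (s j && ~~ s j.+1))%N.
Proof.
rewrite /lpk (card_set_ord _ (fun i => (1 <= i <= n.-1)%N && is_peak u i)).
rewrite big_nat_recl //= add0n; apply: eq_big_nat => j /andP[_ lt_j].
rewrite /is_peak /s /ascent /=.
have [lt|ge] := ltnP j.+1 n.
  by rewrite descentE // !ltn_eqF ?orbF // (_ : (j < n.-1)%N) //; lia.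
rewrite (_ : (j < n.-1)%N = false); last lia.
by rewrite (_ : (j.+1 == n)) ?orbT ?andbF //; lia.
Qed.

Lemma ascent0 m (u : 'S_m.+1) : ascent u 0.
Proof. exact: letter_gt0. Qed.

Lemma middleE m (u : 'S_m.+4) (s := ascent u) :
  middle u = \prod_(2 <= j < m.+2) factor (s j) (~~ s j.+1).
Proof.
by apply: eq_big_nat => j /andP[_ lt_j]; rewrite descentE // ltnS; lia.
Qed.

(** The bits end with false, so [prod_bits] evaluates the doubled product. The two factors [2 phi]
    supply this 2 and the outer one. *)
Lemma prod_B_aff m (u : 'S_m.+4) :
  factorB (letter u 1) (letter u 2) (letter u 3) *
    (middle u * factorB (letter u m.+4) (letter u m.+3) (letter u m.+2)) =
  ((phi u * phi (reversal u)) *: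
      ((4%:R *: 'X) ^+ epk u * (1 + 'X) ^+ (m.+4 + 1 - 2 * epk u)%N)) *+ 2.
Proof.
have /= := prod_bits ('X : {poly rat}) m.+4 (ascent0 u).
rewrite -epk_ascent {1}/ascent letter_out ltn0 => -[_].
rewrite (scaler_nat 4 'X) mulr_natl => <-.
rewrite prod_split4 phiE phi_reversalE middleE /factorB !descentE //.
have ->: ascent u m.+4 = false by rewrite /ascent letter_out.
rewrite -/(ascent u 1) -/(ascent u m.+2) -/(ascent u m.+3) ascent0 /=.
rewrite (factorC 1 (ascent u m.+3)) [in RHS]/= -!/(factor _ _).
rewrite (factorC (~~ ascent u m.+3)).
set a := phi3 _ _ _; set b := phi3 _ _ _.
rewrite -!mul_polyC polyCM.
by move: a%:P b%:P (factor _ _) (factor _ _) (factor _ _) (factor _ _)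
  (\prod_(_ <= _ < _) _) => *; ring.
Qed.

Lemma prod_B_fin m (u : 'S_m.+4) :
  factorB (letter u 1) (letter u 2) (letter u 3) * (middle u * last_fin u) =
  (phi (reversal u) *:
      ((4%:R *: 'X) ^+ lpk u * (1 + 'X) ^+ (m.+4 - 2 * lpk u)%N)) *+ 2.
Proof.
have /= := @prod_bits _ ('X : {poly rat})
  (fun j => ascent u j || (j == m.+4)) m.+4.
rewrite -lpk_ascent ascent0 eqxx orbT => /(_ isT)[_].
rewrite (scaler_nat 4 'X) mulr_natl => <-.
rewrite prod_split4 phi_reversalE middleE /factorB /last_fin !descentE //.
rewrite -/(ascent u 1) -/(ascent u m.+2) -/(ascent u m.+3) ascent0 eqxx orbT.
rewrite !eqSS !(ltn_eqF (ltnSn _)) (ltn_eqF (leqnSn _.+1)) !orbF /=.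
rewrite -!/(factor _ _).
rewrite [in RHS](eq_big_nat _ _ (F2 := fun j =>
  factor (ascent u j) (~~ ascent u j.+1))); last first.
  by move=> j /andP[_ ltj]; rewrite !ltn_eqF ?orbF //; lia.
set a := phi3 _ _ _.
rewrite -!mul_polyC.
by move: a%:P (factor _ _) (factor _ _) (factor _ _) (factor _ _)
  (\prod_(_ <= _ < _) _) => *; ring.
Qed.

(* The exponents n + 1 - 2 epk(u) and n - 2 lpk(u) are never negative, so the
   truncated subtractions are exact. *)
Theorem corollary5p11 (n : nat) (hn : (4 <= n)%N) :
  aff_eulerianD n =
    \sum_(u : 'S_n) (phi u * phi (reversal u)) *:
      ((4%:R *: 'X) ^+ epk u * (1 + 'X) ^+ (n + 1 - 2 * epk u)%N)
  /\
  eulerianD n =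
    \sum_(u : 'S_n) phi (reversal u) *:
      ((4%:R *: 'X) ^+ lpk u * (1 + 'X) ^+ (n - 2 * lpk u)%N).
Proof.
case: n hn => [|[|[|[|m]]]] // _.
(* The sums over [weylD] are known only doubled, so both identities are proved after doubling. *)
have dbl_inj (p q : {poly rat}) : p *+ 2 = q *+ 2 -> p = q.
  by rewrite -!(scaler_nat 2) => /scalerI -> //.
split; apply: dbl_inj; rewrite -[in RHS]sumrMnl.
  rewrite aff_eulerianD_sum; under eq_bigr do rewrite prod_D_aff.
  by rewrite sum_D_aff; apply: eq_bigr => u _; rewrite prod_B_aff.
rewrite eulerianD_sum; under eq_bigr do rewrite prod_D_fin.
by rewrite sum_D_fin; apply: eq_bigr => u _; rewrite prod_B_fin.
Qed.
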